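(* Let $k\ge 2$ be even, let $p$ be a prime coprime to $N$, and let $\sigma$ be an admissible sign pattern for $N$ with $S_k^\sigma(N)\ne0$. Then $$\frac{\#\left\{ \lambda \in \operatorname{eigen}_{S_k^\sigma(N)} ( \mathbf{T}_{p}' ) : \left| \lambda \right| \leq \frac{\log p}{\log kN} \right\}}{\dim S_k^\sigma(N)} \leq \left(C_0 + \frac{3\sqrt{2}}{2\pi} \right) \cdot \frac{\log p}{\log kN}.$$ The same statement holds for $S_k^{\mathrm{new},\sigma}(N)$ in place of $S_k^\sigma(N)$, with $C_0^{\mathrm{new}}$ in place of $C_0$.
   Context: For even $k\ge 2$ and $N\ge 1$, $S_k(N)$ is the space of weight $k$ cusp forms for $\Gamma_0(N)$ and $S_k^{\mathrm{new}}(N)$ is its new subspace. Write $Q\parallel N$ if $Q\mid N$ and $\gcd(Q,N/Q)=1$; $W_Q$ denotes the corresponding Atkin--Lehner involution. A sign pattern for $N$ is a multiplicative function $\sigma:\{Q: Q\parallel N\}\to\{\pm1\}$. Put $S_k^\sigma(N)=\{f\in S_k(N): W_Qf=\sigma(Q)f \text{ for all } Q\parallel N\}$ and $S_k^{\mathrm{new},\sigma}(N)=S_k^{\mathrm{new}}(N)\cap S_k^\sigma(N)$. Over $S_k(N)$ every sign pattern is admissible; over $S_k^{\mathrm{new}}(N)$, $\sigma$ is admissible unless $4\parallel N$ and $\sigma(4)=+1$. $\mathbf{T}_p$ is the Hecke operator and $\mathbf{T}_p'=p^{-(k-1)/2}\mathbf{T}_p$. $\operatorname{eigen}_V(T)$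 is the multiset of eigenvalues of $T$ on $V$ (counts are with multiplicity). Let $$d\mu_p(x) = \frac{p + 1}{2\pi} \cdot \frac{\sqrt{4 - x^2}}{( p^{1/2} + p^{-1/2} )^2 - x^2} \,dx \quad\text{on }[-2,2].$$ $C_0$ denotes an absolute constant such that $$\left| \frac{\# \operatorname{eigen}_{S_k^{\sigma}(N)}(\mathbf{T}'_p) \cap I}{\dim S_k^{\sigma}(N)} - \int_I d \mu_p(x) \right| \le C_0 \frac{\log p}{\log kN}$$ for all primes $p$, levels $N$ coprime to $p$, admissible $\sigma$, even $k\ge2$ and intervals $I\subseteq[-2,2]$ (with $S_k^\sigma(N)\neq0$); $C_0^{\mathrm{new}}$ denotes such a constant for the spaces $S_k^{\mathrm{new},\sigma}(N)$. *)

(* Defs.v *)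
From mathcomp Require Import all_boot all_order all_algebra.
From mathcomp Require Import all_classical all_reals all_analysis.
From mathcomp Require Export complex.

Set Implicit Arguments.
Unset Strict Implicit.
Unset Printing Implicit Defensive.

Import Order.TTheory GRing.Theory Num.Theory numFieldNormedType.Exports.

Local Open Scope classical_set_scope.
Local Open Scope ring_scope.
Local Open Scope complex_scope.

Section LinearAlgebra.
Variables (K : fieldType) (E : lmodType K).
Implicit Types V G : set E.

Definition lin_span G : set E :=
  [set f | exists n (c : 'I_n -> K) (g : 'I_n -> E),
    (forall i, G (g i)) /\ f = \sum_(i < n) c i *: g i].

Definition is_basis V n (b : 'I_n -> E) : Prop :=
  [/\ forall i, V (b i),
      forall c : 'I_n -> K, \sum_(i < n) c i *: b i = 0 -> forall i, c i = 0
    & forall f, V f -> exists c : 'I_n -> K, f = \sum_(i < n) c i *: b i].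

(* The default 0 is used only when V is not finite dimensional. *)
Definition dimension V : nat :=
  xget 0%N [set n | exists b : 'I_n -> E, is_basis V b].

End LinearAlgebra.

Section ModularForms.
Variable R : realType.

Local Notation C := R[i].

(* A function on the upper half-plane is represented by its extension by 0
   to C: cusp_form imposes f z = 0 when Im z <= 0, and all the operators below
   preserve this condition. *)
Local Notation form := (C -> C^o).

(* The multiset of the eigenvalues of T on V, as the list (unique up to
   permutation) of the roots of the characteristic polynomial of T on V,
   repeated according to their multiplicities.  It is a list of real numbers,
   because the Hecke operators it is applied to are self-adjoint for the
   Petersson product; the default [::] is used only when V is not finite
   dimensional, V is not stable under T, or the characteristic polynomial does
   not split over R. *)
Definition eigen (V : set form) (T : form -> form) : seq R :=
  xget [::] [set s : seq R | exists n (b : 'I_n -> form) (M : 'M[C]_n),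
    [/\ is_basis V b,
        forall i, T (b i) = \sum_(j < n) M i j *: b j
      & char_poly M = \prod_(a <- s) ('X - (a%:C)%:P)]].

Definition mobius (A : 'M[int]_2) (z : C) : C :=
  ((A 0 0)%:~R * z + (A 0 1)%:~R) / ((A 1 0)%:~R * z + (A 1 1)%:~R).

(* The power det(A)^(k/2) is taken with k./2: the weight k is always even. *)
Definition slash (k : nat) (A : 'M[int]_2) (f : form) : form :=
  fun z => (\det A)%:~R ^+ k./2 * ((A 1 0)%:~R * z + (A 1 1)%:~R) ^- k
           * f (mobius A z).

Definition SL2Z : set 'M[int]_2 := [set A | \det A = 1].

Definition Gamma0 (N : nat) : set 'M[int]_2 :=
  [set A | SL2Z A /\ (N%:Z %| A 1%R 0%R)%Z].

Definition zero_at_im_infty (f : form) : Prop :=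
  forall e : R, 0 < e -> exists Y : R,
    forall z : C, Y < complex.Im z -> `|f z : C| < e%:C.

(* S_k(N) *)
Definition cusp_form (k N : nat) : set form :=
  [set f |
    [/\ forall z : C, complex.Im z <= 0 -> f z = 0,
        forall z : C, 0 < complex.Im z -> derivable (f : C^o -> C^o) z 1,
        forall A, Gamma0 N A -> slash k A f = f
      & forall A, SL2Z A -> zero_at_im_infty (slash k A f)]].

Definition hecke (k p : nat) (f : form) : form :=
  fun z => p%:R ^+ (k - 1) * f (p%:R * z)
           + p%:R^-1 * \sum_(b < p) f ((z + b%:R) / p%:R).

Definition hecke_normalized (k p : nat) (f : form) : form :=
  ((Num.sqrt p%:R)%:C ^- (k - 1)) *: hecke k p f.

Definition exact_divisor (Q N : nat) : bool :=
  (Q %| N)%N && coprime Q (N %/ Q).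

Definition atkin_lehner_mx (N Q : nat) : set 'M[int]_2 :=
  [set A | [/\ \det A = Q%:Z, (Q%:Z %| A 0%R 0%R)%Z, (N%:Z %| A 1%R 0%R)%Z
             & (Q%:Z %| A 1%R 1%R)%Z]].

(* On S_k(N), the result does not depend on the matrix that is chosen. *)
Definition atkin_lehner (k N Q : nat) (f : form) : form :=
  slash k (xget 1 (atkin_lehner_mx N Q)) f.

(* Only the values of s at the exact divisors of N are meaningful. *)
Definition sign_pattern (N : nat) (s : nat -> int) : Prop :=
  [/\ forall Q, exact_divisor Q N -> s Q = 1 \/ s Q = -1,
      s 1%N = 1
    & forall Q Q', exact_divisor Q N -> exact_divisor Q' N -> coprime Q Q' ->
        s (Q * Q')%N = s Q * s Q'].

Definition admissible_new (N : nat) (s : nat -> int) : Prop :=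
  ~ (exact_divisor 4 N /\ s 4%N = 1).

(* S_k^s(N) *)
Definition cusp_sign (k N : nat) (s : nat -> int) : set form :=
  [set f | cusp_form k N f /\
    forall Q, exact_divisor Q N -> atkin_lehner k N Q f = (s Q)%:~R *: f].

(* A measurable set of representatives of the orbits of Gamma0(N) on the upper
   half-plane, with x + iy represented by (x, y). *)
Definition fundamental_domain (N : nat) (D : set (R * R)) : Prop :=
  [/\ measurable D,
      forall w, D w -> 0 < w.2
    & forall z : C, 0 < complex.Im z ->
        exists! w : R * R, D w /\
          exists A, Gamma0 N A /\ mobius A z = w.1 +i* w.2].

(* The integral over Gamma0(N)\H of f(z) conj(g(z)) y^k dx dy / y^2; for f and g
   in S_k(N), it does not depend on the fundamental domain that is chosen. *)
Definition petersson (k N : nat) (f g : form) : C :=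
  let D := xget set0 (fundamental_domain N) in
  let mu := ((@lebesgue_measure R) \x (@lebesgue_measure R))%E in
  let F := fun w : R * R =>
    (f (w.1 +i* w.2) : C) * (g (w.1 +i* w.2) : C)^*
      * (w.2 ^+ k / w.2 ^+ 2)%:C in
  (\int[mu]_(w in D) complex.Re (F w)) +i* (\int[mu]_(w in D) complex.Im (F w)).

Definition cusp_old (k N : nat) : set form :=
  lin_span [set f | exists M d (g : form),
    [/\ (d * M %| N)%N, (M < N)%N, cusp_form k M g
      & f = fun z => g (d%:R * z)]].

Definition cusp_new (k N : nat) : set form :=
  [set f | cusp_form k N f /\ forall g, cusp_old k N g -> petersson k N f g = 0].

Definition cusp_new_sign (k N : nat) (s : nat -> int) : set form :=
  cusp_new k N `&` cusp_sign k N s.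

Definition nonzero_space (V : set form) : Prop := exists2 f, V f & f <> 0.

Definition mu_density (p : nat) (x : R) : R :=
  (p%:R + 1) / (2 * pi) *
  (Num.sqrt (4 - x ^+ 2) /
   ((Num.sqrt p%:R + (Num.sqrt p%:R)^-1) ^+ 2 - x ^+ 2)).

Definition mu_integral (p : nat) (I : set R) : R :=
  \int[@lebesgue_measure R]_(x in I) mu_density p x.

Definition eigen_ratio (k p : nat) (V : set form) (A : set R) : R :=
  (count (fun x => x \in A) (eigen V (hecke_normalized k p)))%:R
  / (dimension V)%:R.

Definition equidistribution_constant
    (admissible : nat -> (nat -> int) -> Prop)
    (S : nat -> nat -> (nat -> int) -> set form) (C0 : R) : Prop :=
  forall (k p N : nat) (s : nat -> int) (I : interval R),
    (2 <= k)%N -> ~~ odd k -> prime p -> (0 < N)%N -> coprime p N ->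
    sign_pattern N s -> admissible N s -> nonzero_space (S k N s) ->
    [set` I] `<=` `[-2, 2] ->
    `|eigen_ratio k p (S k N s) [set` I] - mu_integral p [set` I]|
      <= C0 * (ln p%:R / ln (k * N)%:R).

End ModularForms.

(* Main.v *)
(** Let [x = log p / log (kN) > 0].  If [x <= 2], apply the equidistribution
    hypothesis to [[-x, x]]: the density of [mu_p] is at most
    [3 sqrt 2 / (4 pi)].  If [x > 2], the proportion is at most 1, which is less
    than [3 sqrt 2 / (2 pi) * x] because [pi < 4], and the hypothesis on the
    interval [[0, 0]] gives [C0 * x >= 0]. *)

Require Import Defs.
From mathcomp Require Import all_boot all_order all_algebra.
From mathcomp Require Import all_classical all_reals all_analysis.
From mathcomp Require Import ring lra.
Set Implicit Arguments.
Unset Strict Implicit.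
Unset Printing Implicit Defensive.

Import Order.TTheory GRing.Theory Num.Theory numFieldNormedType.Exports.
Local Open Scope classical_set_scope.
Local Open Scope ring_scope.

(** Expanding each basis in the other gives matrices with [A *m B = 1] of size [m], and the rank
    then forces [m <= n]. This makes [dimension] independent of the basis that [xget] picks. *)
Lemma is_basis_leq (K : fieldType) (E : lmodType K) (V : set E) (m n : nat)
    (b : 'I_m -> E) (b' : 'I_n -> E) :
  is_basis V b -> is_basis V b' -> (m <= n)%N.
Proof.
move=> [Vb freeb genb] [Vb' _ genb'].
have [A bA] := choice (fun i => genb' _ (Vb i)).
have [B b'B] := choice (fun j => genb _ (Vb' j)).
apply: (@mulmx1_min K m n (\matrix_(i, j) A i j) (\matrix_(i, j) B i j)).
apply/matrixP => i l; rewrite !mxE; apply/eqP; rewrite -subr_eq0; apply/eqP.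
rewrite (eq_bigr (fun j => A i j * B j l)); last by move=> j _; rewrite !mxE.
(* Row [i] of [A *m B - 1] is a linear relation among the [b l]. *)
apply: (freeb (fun l => \sum_j A i j * B j l - (i == l)%:R)).
under eq_bigr do rewrite scalerBl scaler_suml.
rewrite sumrB exchange_big /=.
under [X in X - _]eq_bigr
  do [under eq_bigr do rewrite -scalerA; rewrite -scaler_sumr -b'B].
rewrite -bA (bigD1 i) //= eqxx scale1r big1 ?addr0 ?subrr // => j.
by rewrite eq_sym => /negbTE ->; rewrite scale0r.
Qed.

Lemma dimensionP (K : fieldType) (E : lmodType K) (V : set E) (n : nat)
    (b : 'I_n -> E) :
  is_basis V b -> dimension V = n.
Proof.
move=> Vb; rewrite /dimension; case: xgetP => [m _ [b' Vb']|/(_ n)[]].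
  by apply/eqP; rewrite eqn_leq (is_basis_leq Vb' Vb) (is_basis_leq Vb Vb').
by exists b.
Qed.

Section Bounds.
Variable R : realType.
Implicit Types (k p N : nat) (V : set (R[i] -> (R[i])^o)) (x : R).

(** The characteristic polynomial has degree [n], the length of a basis. Only an inequality holds in
    general, because of the default [[::]]. *)
Lemma size_eigen V T : (size (eigen V T) <= dimension V)%N.
Proof.
rewrite /eigen; case: xgetP => [s _ [n [b [M [Vb _ charM]]]]|//].
have := size_char_poly M; rewrite charM size_prod_XsubC => -[->].
by rewrite (dimensionP Vb).
Qed.

Lemma eigen_ratio_le1 k p V A : eigen_ratio k p V A <= 1.
Proof.
rewrite /eigen_ratio; have [->|dim_gt0] := posnP (dimension V).
  (* In dimension 0 the quotient is 0, by the convention on [0^-1]. *)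
  by rewrite invr0 mulr0 ler01.
by rewrite ler_pdivrMr ?ltr0n// mul1r ler_nat (leq_trans (count_size _ _))// size_eigen.
Qed.

(** Isolates the square of [sqrt (4 - x^2)], the factor in the numerator of the density; the
    remainder [p - 2 + 1/p] is positive for [p >= 2]. *)
Lemma mu_denominatorE p x : (0 < p)%N ->
  (Num.sqrt p%:R + (Num.sqrt p%:R)^-1) ^+ 2 - x ^+ 2
  = (4 - x ^+ 2) + (p%:R - 2 + p%:R^-1).
Proof.
move=> p0.
have s0 : Num.sqrt p%:R != 0 :> R by rewrite gt_eqF// sqrtr_gt0 ltr0n.
rewrite -[in RHS](@sqr_sqrtr _ p%:R) ?ler0n//.
by move: (Num.sqrt _) s0 => u u0; field.
Qed.

Lemma mu_denominator_gt0 p x : (1 < p)%N -> `|x| <= 2 ->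
  0 < (Num.sqrt p%:R + (Num.sqrt p%:R)^-1) ^+ 2 - x ^+ 2.
Proof.
move=> p1 x2; rewrite mu_denominatorE ?(ltnW p1)//.
have p2 : 2 <= p%:R :> R by rewrite ler_nat.
have pV : 0 < (p%:R)^-1 :> R by rewrite invr_gt0; lra.
have : x ^+ 2 <= 4 by rewrite -real_normK ?num_real//; have := normr_ge0 x; nra.
lra.
Qed.

(* With u = sqrt (4 - x^2), the denominator is u^2 + p - 2 + 1/p; the worst
   case is p = 2 and u = 1 / sqrt 2. *)
Lemma mu_density_le p x : (1 < p)%N -> `|x| <= 2 ->
  mu_density p x <= 3 * Num.sqrt 2 / (4 * pi).
Proof.
move=> p1 x2; have := mu_denominator_gt0 p1 x2.
rewrite /mu_density mu_denominatorE ?(ltnW p1)//.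
have x4 : 0 <= 4 - x ^+ 2.
  by rewrite subr_ge0 -real_normK ?num_real//; have := normr_ge0 x; nra.
have u0 := sqrtr_ge0 (4 - x ^+ 2); have u2 := sqr_sqrtr x4.
have x20 := sqr_ge0 x.
rewrite -{}[X in 0 < X + _]u2 -[X in _ / (X + _)](sqr_sqrtr x4).
have {x20} : Num.sqrt (4 - x ^+ 2) <= 2.
  by rewrite -(@ler_pXn2r _ 2) ?nnegrE//; rewrite sqr_sqrtr//; lra.
move: (Num.sqrt (4 - x ^+ 2)) u0 => u u0 u2 D0.
have -> : 3 * Num.sqrt 2 / (4 * pi) = 3 / 2 * Num.sqrt 2 / (2 * pi) :> R.
  by move: (Num.sqrt 2 : R) (lt0r_neq0 (pi_gt0 R)) => t; move: pi => q q0; field.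
rewrite mulrACA -invfM [2 * pi * _]mulrC invfM mulrA.
rewrite ler_pM2r ?invr_gt0 ?mulr_gt0 ?pi_gt0// ler_pdivrMr//.
have := sqrtr_ge0 (2 : R); have := @sqr_sqrtr R 2 (ler0n _ _).
move: (Num.sqrt 2 : R) => t tt t0.
move: p1; rewrite leq_eqVlt => /orP[/eqP <-|p3].
  (* For [p = 2] and [t^2 = 2], the goal is this inequality multiplied by a positive multiple of
     [t]. *)
  have := sqr_ge0 (t * u - 1); nra.
have p3' : 3 <= p%:R :> R by rewrite ler_nat.
have pV : 0 < (p%:R)^-1 :> R by rewrite invr_gt0; lra.
(* Hence [3 / 2 * t >= 2], and a bound with the rational constant 2 suffices for [p >= 3]. *)
have t43 : 4 / 3 <= t by nra.
apply: (@le_trans _ _ (2 * (u ^+ 2 + (p%:R - 2 + p%:R^-1)))).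
  (* The difference of the two sides is [2 (u - 1)^2 + (p - 3) (2 - u) + 2/p]. *)
  have := sqr_ge0 (u - 1); nra.
by rewrite ler_pM2r//; lra.
Qed.

(** Continuity is two-sided even at [x = 2] and [x = -2], since [Num.sqrt] is 0 on negative numbers.
    It serves to integrate the density over a segment. *)
Lemma continuous_mu_density p x : (1 < p)%N -> `|x| <= 2 ->
  {for x, continuous (@mu_density R p)}.
Proof.
move=> p1 x2; rewrite /mu_density.
apply: cvgM; first exact: cvg_cst.
apply: cvgM.
  apply: continuous_comp; last exact: sqrt_continuous.
  by apply: cvgB; [exact: cvg_cst|exact: exprn_continuous].
apply: cvgV; first by rewrite gt_eqF ?mu_denominator_gt0.
by apply: cvgB; [exact: cvg_cst|exact: exprn_continuous].
Qed.

Lemma mu_integral_le p x : (1 < p)%N -> 0 <= x <= 2 ->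
  mu_integral p `[- x, x] <= 3 * Num.sqrt 2 / (2 * pi) * x.
Proof.
move=> p1 /andP[x0 x2].
have sub2 (y : R) : `[- x, x]%classic y -> `|y| <= 2.
  by rewrite /= in_itv /= -ler_norml => /le_trans; apply.
apply: (@le_trans _ _
  (\int[@lebesgue_measure R]_(y in `[- x, x]) (3 * Num.sqrt 2 / (4 * pi)))).
  apply: le_Rintegral => //=.
  - apply: continuous_compact_integrable; first exact: segment_compact.
    apply: continuous_in_subspaceT => y; rewrite inE => /sub2.
    exact: continuous_mu_density.
  - apply: continuous_compact_integrable; first exact: segment_compact.
    by apply: continuous_subspaceT => y; exact: cvg_cst.
  - by move=> y /sub2; exact: mu_density_le.
rewrite Rintegral_cst//= lebesgue_measure_itv/= lte_fin.
have pi0 := pi_gt0 R.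
(* The length of the interval is given by cases; it is 0 when [- x < x] fails, that is, when
   [x = 0]. *)
case: ifPn => _ /=; last first.
  by rewrite mulr0 mulr_ge0 ?divr_ge0 ?mulr_ge0 ?sqrtr_ge0 ?pi_ge0.
move: (Num.sqrt 2 : R) (lt0r_neq0 pi0) => t; move: pi => q q0.
by rewrite le_eqVlt; apply/predU1P; left; field.
Qed.

(** Stated for an arbitrary [V], so that the full space and the new subspace share one argument. *)
Lemma low_lying_ratio k p V (C0 x : R) : (1 < p)%N -> 0 < x ->
  (forall I : interval R, [set` I] `<=` `[-2, 2] ->
     `|eigen_ratio k p V [set` I] - mu_integral p [set` I]| <= C0 * x) ->
  eigen_ratio k p V [set y : R | `|y| <= x]
    <= (C0 + 3 * Num.sqrt 2 / (2 * pi)) * x.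
Proof.
move=> p1 x0 equi; rewrite mulrDl.
have [x2|x2] := leP x 2.
  have -> : [set y : R | `|y| <= x] = `[- x, x]%classic.
    by apply/seteqP; split => y /=; rewrite in_itv/= ler_norml.
  have /equi equix : `[- x, x] `<=` `[-2, 2].
    by move=> y /=; rewrite !in_itv/= => /andP[? ?]; apply/andP; split; lra.
  have le_mu : mu_integral p `[- x, x] <= 3 * Num.sqrt 2 / (2 * pi) * x.
    by rewrite mu_integral_le// (ltW x0).
  by move: (le_trans (ler_norm _) equix) le_mu; lra.
(* The sign of [C0] is not assumed: it comes from bounding an absolute value. *)
have C0x : 0 <= C0 * x.
  by apply: le_trans (equi `[0, 0] _) => // y /=; rewrite !in_itv/=; lra.
apply: (le_trans (eigen_ratio_le1 _ _ _ _)).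
have pi0 := pi_gt0 R.
have t43 : 4 / 3 <= Num.sqrt 2 :> R.
  by rewrite -(@ler_pXn2r _ 2) ?nnegrE ?sqrtr_ge0// sqr_sqrtr//; lra.
(* Here [3 * sqrt 2 >= 4 > pi]; with [x > 2] the product with [x] exceeds 1. *)
have : 1 / 2 <= 3 * Num.sqrt 2 / (2 * pi) :> R.
  by rewrite ler_pdivlMr ?mulr_gt0//; have := pihalf_lt2 R; lra.
nra.
Qed.

Lemma ln_ratio_gt0 k p N : (2 <= k)%N -> (1 < p)%N -> (0 < N)%N ->
  0 < ln p%:R / ln (k * N)%:R :> R.
Proof.
move=> k2 p1 N0; rewrite divr_gt0// ln_gt0// ltr1n//.
by rewrite (leq_trans k2)// leq_pmulr.
Qed.

End Bounds.

Theorem proposition1p3 (R : realType) :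
  (forall C0 : R,
     equidistribution_constant (fun _ _ => True) (@cusp_sign R) C0 ->
     forall (k p N : nat) (s : nat -> int),
       (2 <= k)%N -> ~~ odd k -> prime p -> (0 < N)%N -> coprime p N ->
       sign_pattern N s -> nonzero_space (@cusp_sign R k N s) ->
       eigen_ratio k p (@cusp_sign R k N s)
           [set x : R | `|x| <= ln p%:R / ln (k * N)%:R]
         <= (C0 + 3 * Num.sqrt 2 / (2 * pi)) * (ln p%:R / ln (k * N)%:R)) /\
  (forall C0new : R,
     equidistribution_constant admissible_new (@cusp_new_sign R) C0new ->
     forall (k p N : nat) (s : nat -> int),
       (2 <= k)%N -> ~~ odd k -> prime p -> (0 < N)%N -> coprime p N ->
       sign_pattern N s -> admissible_new N s ->
       nonzero_space (@cusp_new_sign R k N s) ->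
       eigen_ratio k p (@cusp_new_sign R k N s)
           [set x : R | `|x| <= ln p%:R / ln (k * N)%:R]
         <= (C0new + 3 * Num.sqrt 2 / (2 * pi)) * (ln p%:R / ln (k * N)%:R)).
Proof.
split=> C0 equi k p N s k2 keven pp N0 copN *; have p1 := prime_gt1 pp.
  by apply: low_lying_ratio (ln_ratio_gt0 _ _ _ _) _ => // I I2; exact: equi.
by apply: low_lying_ratio (ln_ratio_gt0 _ _ _ _) _ => // I I2; exact: equi.
Qed.
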